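(* Consider the linear stochastic system, the open-loop problem and the closed-loop indirect-feedback MPC algorithm described in the context. Assume that the following holds. (i) The set $\mathbb{Z}_f\subseteq\mathbb{R}^n$ is nonempty, and for all $z\in\mathbb{Z}_f$ and $i=1,\ldots,m_x$: $c_i^\top z\le p_i-\sup_{j\in\mathbb{N}_0}\rho(c_i^\top E_j)$. (ii) There exists $v_f\in\mathbb{V}$ such that for all $z\in\mathbb{Z}_f$: $(A+BK)z+Bv_f+\mathbb{E}[W(0)]\in\mathbb{Z}_f$, and $d_i^\top(Kz+v_f)\le q_i-\sup_{j\in\mathbb{N}_0}\rho(d_i^\top KE_j)$ for $i=1,\ldots,m_u$. Assume also that the initial state is feasible, i.e. the open-loop problem is feasible at time $j=0$. Then the risk-averse constraints are satisfied in closed loop, i.e. $$\rho(c_i^\top X^{cl}(j))\le p_i,\quad i=1,\ldots,m_x,\qquad \rho(d_i^\top U^{cl}(j))\le q_i,\quad i=1,\ldots,m_u,$$ hold for all times $j\in\mathbb{N}_0$, where $X^{cl}(j)$ and $U^{cl}(j)$ are generated pointwise in $\omega$ by the algorithm.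
   Context: Setting. $(\Omega,\mathcal{F},\mathbb{P})$ is a probability space and $\mathcal{R}(\Omega,\mathcal{Y})$ is the set of $\mathcal{Y}$-valued random variables. $A\in\mathbb{R}^{n\times n}$, $B\in\mathbb{R}^{n\times l}$, $(A,B)$ controllable. The system is $X(k+1)=AX(k)+BU(k)+W(k)$, $X(0)=X_0\in\mathcal{R}(\Omega,\mathbb{R}^n)$, where $W(0),W(1),\ldots$ are i.i.d. $\mathbb{R}^n$-valued random variables with finite mean (not necessarily Gaussian), $\mathcal{F}_k=\sigma(X(0),\ldots,X(k))$, controls are adapted ($\sigma(U(k))\subseteq\mathcal{F}_k$), and $W(k)$ is independent of $X(k)$ and of every admissible (i.e. $\mathcal{F}_k$-measurable) $U(k)$. The stage cost is $\ell(X,U)=\mathbb{E}[g(X,U)]$ with $g:\mathbb{R}^n\times\mathbb{R}^l\to\mathbb{R}$ continuous and bounded from below; the terminal cost is $F(X)=\mathbb{E}[g_f(X)]$ with $g_f:\mathbb{R}^n\to\mathbb{R}$. Risk measure. $\rho:\mathcal{R}(\Omega,\mathbb{R})\to\mathbb{R}\cup\{+\infty\}$ is translative ($\rho(Y+c)=\rho(Y)+c$ for $c\in\mathbb{R}$), monotone ($\rho(Y_1)\ge\rho(Y_2)$ if $Y_1\ge Y_2$ a.s.) and law-invariant ($\rho(Y)=\rho(Z)$ if $Y\sim Z$). Given are $c_i\in\mathbb{R}^n$, $p_i\in\mathbb{R}$ ($i=1,\ldots,m_x$) and $d_i\in\mathbb{R}^l$, $q_i\in\mathbb{R}$ ($i=1,\ldots,m_u$).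 Open-loop problem. Fix a stabilizing gain $K\in\mathbb{R}^{l\times n}$ (all eigenvalues of $A+BK$ lie in the open unit disc), $\mathbb{V}\subseteq\mathbb{R}^l$, $\mathbb{Z}_f\subseteq\mathbb{R}^n$ and a horizon $N\in\mathbb{N}$, $N\ge1$. At time $j$, for data $x_j\in\mathbb{R}^n$, $z_j\in\mathbb{R}^n$, $E_j\in\mathcal{R}(\Omega,\mathbb{R}^n)$, minimize over $\mathbf{v}=(v_0,\ldots,v_{N-1})\in\mathbb{V}^N$ the cost $\sum_{k=0}^{N-1}\ell(X(k),U(k))+F(X(N))$ subject to: $X(0)=x_j$, $X(k+1)=(A+BK)X(k)+Bv_k+W(j+k)$, $U(k)=KX(k)+v_k$; $z(0)=z_j$, $z(k+1)=(A+BK)z(k)+Bv_k+\mathbb{E}[W(j+k)]$; $E(0)=E_j$, $E(k+1)=(A+BK)E(k)+W(j+k)-\mathbb{E}[W(j+k)]$; $z(N)\in\mathbb{Z}_f$; and for $k=0,\ldots,N-1$: $c_i^\top z(k)\le p_i-\rho(c_i^\top E(k))$ ($i=1,\ldots,m_x$), $d_i^\top(Kz(k)+v_k)\le q_i-\rho(d_i^\top KE(k))$ ($i=1,\ldots,m_u$). The problem is feasible if some $\mathbf{v}$ satisfies all these constraints. Closed-loop algorithm. Initialize $X^{cl}(0)=X_0$, $Z^{cl}(0)=z_0=\mathbb{E}[X_0]$, $E_0=X_0-z_0$. For $j=0,1,\ldots$ and each $\omega$: with $x_j=X^{cl}(j,\omega)$, $z_j=Z^{cl}(j,\omega)$, solve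 the open-loop problem for $(x_j,z_j,E_j)$ to obtain an optimal solution $\mathbf{v}^*=(v_0^*,\ldots,v_{N-1}^* )$ (an optimal solution is presumed to exist whenever the problem is feasible); set $V^{cl}(j,\omega)=v_0^*$, $U^{cl}(j,\omega)=Kx_j+v_0^*$, $Z^{cl}(j+1,\omega)=(A+BK)z_j+Bv_0^*+\mathbb{E}[W(j)]$, $X^{cl}(j+1,\omega)=Ax_j+BU^{cl}(j,\omega)+W(j,\omega)$; and, as random variable, $E_{j+1}=(A+BK)E_j+W(j)-\mathbb{E}[W(j)]$. The controls are chosen measurably, so that $U^{cl}(j)$ and $Z^{cl}(j+1)$ are measurable with respect to $\sigma(X^{cl}(0),\ldots,X^{cl}(j))$. *)

(* Defs.v *)
From HB Require Import structures.
From mathcomp Require Import all_boot all_order all_algebra finmap.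
From mathcomp Require Import complex.
From mathcomp Require Import all_classical all_reals all_analysis.
From mathcomp Require Import measurable_realfun.

Set Implicit Arguments.
Unset Strict Implicit.
Unset Printing Implicit Defensive.

Import Order.TTheory GRing.Theory Num.Theory.
Import numFieldNormedType.Exports.

Local Open Scope classical_set_scope.
Local Open Scope ring_scope.

(* The sigma-algebra on matrices generated by the entries, as the library does
   for tuples; over the reals it is the Borel sigma-algebra. *)
Section measurable_matrix.
Context {R : realType} (m n : nat).

Definition entries_sigma : set (set 'M[R]_(m, n)) :=
  <<s \bigcup_(ij : 'I_m * 'I_n)
        preimage_set_system setT (fun M : 'M[R]_(m, n) => M ij.1 ij.2)
          measurable >>.

Let entries_set0 : entries_sigma set0.
Proof. exact: sigma_algebra0. Qed.

Let entries_setC A : entries_sigma A -> entries_sigma (~` A).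
Proof. exact: sigma_algebraC. Qed.

Let entries_bigcup (F : (set 'M[R]_(m, n))^nat) :
  (forall i, entries_sigma (F i)) -> entries_sigma (\bigcup_i F i).
Proof. exact: sigma_algebra_bigcup. Qed.

HB.instance Definition _ := @isMeasurable.Build default_measure_display
  'M[R]_(m, n) entries_sigma entries_set0 entries_setC entries_bigcup.

Lemma measurable_entry i j :
  measurable_fun [set: 'M[R]_(m, n)] (fun M => M i j).
Proof.
move=> _ Y mY; apply: sub_sigma_algebra.
by exists (i, j) => //; exists Y.
Qed.

Lemma measurable_matrixP d (T : measurableType d) (f : T -> 'M[R]_(m, n)) :
  (forall i j, measurable_fun setT (fun w => f w i j)) ->
  measurable_fun setT f.
Proof.
move=> mf.
apply: (measurability (\bigcup_(ij : 'I_m * 'I_n)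
  preimage_set_system setT (fun M : 'M[R]_(m, n) => M ij.1 ij.2) measurable)).
  by [].
move=> _ [_ [[i j] _ [B mB <-]] <-].
rewrite setTI; have := mf i j measurableT B mB.
by rewrite !setTI.
Qed.

End measurable_matrix.

Section dot.
Context {R : realType} {n : nat}.

Definition dot (c x : 'cV[R]_n) : R := (c^T *m x) 0 0.

Lemma measurable_dot c : measurable_fun setT (dot c).
Proof.
rewrite (_ : dot c = fun x => \sum_(i < n) c i 0 * x i 0); last first.
  by apply/funext => x; rewrite /dot mxE; apply: eq_bigr => i _; rewrite mxE.
apply: measurable_sum => i; apply: measurable_funM => //.
exact: measurable_entry.
Qed.

HB.instance Definition _ c := isMeasurableFun.Build _ _ _ _ (dot c)
  (measurable_dot c).

End dot.

Section linear_maps.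
Context {R : realType}.

Lemma measurable_mulmx m n (A : 'M[R]_(m, n)) :
  measurable_fun setT (fun x : 'cV[R]_n => A *m x).
Proof.
apply: measurable_matrixP => i j.
rewrite (_ : (fun w => _) = fun x : 'cV[R]_n => \sum_(k < n) A i k * x k j);
  last by apply/funext => x; rewrite mxE.
apply: measurable_sum => k; apply: measurable_funM => //.
exact: measurable_entry.
Qed.

HB.instance Definition _ m n (A : 'M[R]_(m, n)) :=
  isMeasurableFun.Build _ _ 'cV[R]_n 'cV[R]_m (mulmx A) (measurable_mulmx A).

End linear_maps.

Section linear_systems.
Context {R : realType} {n l : nat}.
Variables (A : 'M[R]_n) (B : 'M[R]_(n, l)).

Fixpoint lin_state (x0 : 'cV[R]_n) (u : nat -> 'cV[R]_l) (k : nat) :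
    'cV[R]_n :=
  if k is k'.+1 then A *m lin_state x0 u k' + B *m u k' else x0.

Definition controllable :=
  forall x0 x1 : 'cV[R]_n, exists k u, lin_state x0 u k = x1.

Definition stabilizing (K : 'M[R]_(l, n)) :=
  forall lam : R[i],
    eigenvalue (map_mx (real_complex R) (A + B *m K)) lam -> `|lam| < 1.

End linear_systems.

Section random_vectors.
Context d {T : measurableType d} {R : realType} (P : probability T R).

Definition finite_mean n (X : {RV P >-> 'cV[R]_n}) :=
  forall i, P.-integrable setT (fun w => (X w i 0)%:E).

Definition mean n (X : {RV P >-> 'cV[R]_n}) : 'cV[R]_n :=
  \col_i fine 'E_P[fun w => X w i 0].

Definition same_law d' (S : measurableType d') (X Y : {RV P >-> S}) :=
  forall C : set S, measurable C -> distribution P X C = distribution P Y C.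

Definition indep d1 d2 (S1 : measurableType d1) (S2 : measurableType d2)
    (X : {RV P >-> S1}) (Y : {RV P >-> S2}) :=
  forall C1 C2, measurable C1 -> measurable C2 ->
    P (X @^-1` C1 `&` Y @^-1` C2) = (P (X @^-1` C1) * P (Y @^-1` C2))%E.

Definition mutually_indep d' (S : measurableType d')
    (X : nat -> {RV P >-> S}) :=
  forall (J : {fset nat}) (C : nat -> set S),
    (forall k, measurable (C k)) ->
    P (\bigcap_(k in [set` J]) (X k @^-1` C k)) =
    (\prod_(k <- J) P (X k @^-1` C k))%E.

Definition iid d' (S : measurableType d') (X : nat -> {RV P >-> S}) :=
  mutually_indep X /\ forall k, same_law (X k) (X 0%N).

(* sigma(X 0, ..., X k) *)
Definition history d' (S : measurableType d') (X : nat -> {RV P >-> S})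
    (k : nat) : set (set T) :=
  <<s \bigcup_(i in [set i | (i <= k)%N])
        preimage_set_system setT (X i) measurable >>.

(* sigma(Y) is included in G *)
Definition measurable_wrt d' (S : measurableType d') (G : set (set T))
    (Y : {RV P >-> S}) :=
  preimage_set_system setT Y measurable `<=` G.

Record risk_measure (rho : {RV P >-> R} -> \bar R) : Prop := RiskMeasure {
  risk_neq_ninfty : forall Y, rho Y != -oo%E;
  risk_translative : forall (Y : {mfun T >-> R}) (a : R),
    rho (Y + cst a) = (rho Y + a%:E)%E;
  risk_monotone : forall Y1 Y2 : {RV P >-> R},
    {ae P, forall w, Y2 w <= Y1 w} -> (rho Y2 <= rho Y1)%E;
  risk_law_invariant : forall Y Z : {RV P >-> R},
    same_law Y Z -> rho Y = rho Z }.

End random_vectors.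

Section standing_assumptions.
Context d {T : measurableType d} {R : realType} (P : probability T R).
Context {n l : nat}.
Variables (A : 'M[R]_n) (B : 'M[R]_(n, l)).
Variables (X0 : {RV P >-> 'cV[R]_n}) (W : nat -> {RV P >-> 'cV[R]_n}).

Record admissible_process (X : nat -> {RV P >-> 'cV[R]_n})
    (U : nat -> {RV P >-> 'cV[R]_l}) : Prop := AdmissibleProcess {
  process_init : forall w, X 0%N w = X0 w;
  process_step : forall k w, X k.+1 w = A *m X k w + B *m U k w + W k w;
  process_adapted : forall k, measurable_wrt (history X k) (U k) }.

Definition noise_indep_of_past :=
  forall X U, admissible_process X U ->
    forall k, indep (W k) (X k) /\ indep (W k) (U k).

End standing_assumptions.

Section stage_costs.
Context d {T : measurableType d} {R : realType} (P : probability T R).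
Context {n l : nat}.

Definition stage_cost (g : 'cV[R]_n * 'cV[R]_l -> R)
    (X : T -> 'cV[R]_n) (U : T -> 'cV[R]_l) : \bar R :=
  'E_P[fun w => g (X w, U w)].

Definition terminal_cost (gf : 'cV[R]_n -> R) (X : T -> 'cV[R]_n) : \bar R :=
  'E_P[fun w => gf (X w)].

End stage_costs.

Section open_loop.
Context d {T : measurableType d} {R : realType} (P : probability T R).
Context {n l : nat}.
Variables (A : 'M[R]_n) (B : 'M[R]_(n, l)) (K : 'M[R]_(l, n)).
Variable W : nat -> {RV P >-> 'cV[R]_n}.

(* The open-loop error started from E at time j. *)
Fixpoint ol_error (j : nat) (E : T -> 'cV[R]_n) (k : nat) : T -> 'cV[R]_n :=
  if k is k'.+1 then fun w =>
    (A + B *m K) *m ol_error j E k' w + W (j + k')%N w - mean (W (j + k')%N)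
  else E.

Lemma measurable_ol_error j (E : {RV P >-> 'cV[R]_n}) k :
  measurable_fun setT (ol_error j E k).
Proof.
elim: k => [|k IHk] /=; first exact: measurable_funPT.
apply: measurable_matrixP => i c.
rewrite (_ : (fun w => _) = fun w =>
    ((A + B *m K) *m ol_error j E k w) i c + W (j + k)%N w i c
    - mean (W (j + k)%N) i c); last by apply/funext => w; rewrite !mxE.
apply: measurable_funB; last exact: measurable_cst.
apply: measurable_funD.
  apply: (measurableT_comp (measurable_entry i c)).
  exact: (measurableT_comp (measurable_mulmx _)).
apply: (measurableT_comp (measurable_entry i c)).
exact: measurable_funPT.
Qed.

HB.instance Definition _ j (E : {RV P >-> 'cV[R]_n}) k :=
  isMeasurableFun.Build _ _ _ _ (ol_error j E k) (measurable_ol_error j E k).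

Section nominal_and_state.
Variables (j : nat) (v : seq 'cV[R]_l).

Fixpoint ol_nominal (z : 'cV[R]_n) (k : nat) : 'cV[R]_n :=
  if k is k'.+1 then
    (A + B *m K) *m ol_nominal z k' + B *m v`_k' + mean (W (j + k')%N)
  else z.

Fixpoint ol_state (x : 'cV[R]_n) (k : nat) : T -> 'cV[R]_n :=
  if k is k'.+1 then fun w =>
    (A + B *m K) *m ol_state x k' w + B *m v`_k' + W (j + k')%N w
  else cst x.

Definition ol_input (x : 'cV[R]_n) (k : nat) : T -> 'cV[R]_l :=
  fun w => K *m ol_state x k w + v`_k.

End nominal_and_state.

Variables (N : nat) (V : set 'cV[R]_l) (Zf : set 'cV[R]_n).
Variables (g : 'cV[R]_n * 'cV[R]_l -> R) (gf : 'cV[R]_n -> R).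
Variables (rho : {RV P >-> R} -> \bar R).
Context {mx mu : nat}.
Variables (c : 'I_mx -> 'cV[R]_n) (p : 'I_mx -> R).
Variables (dd : 'I_mu -> 'cV[R]_l) (q : 'I_mu -> R).

Definition ol_cost (j : nat) (x : 'cV[R]_n) (v : N.-tuple 'cV[R]_l) : \bar R :=
  (\sum_(k < N) stage_cost P g (ol_state j v x k) (ol_input j v x k)
   + terminal_cost P gf (ol_state j v x N))%E.

Record ol_feasible (j : nat) (z : 'cV[R]_n) (E : {RV P >-> 'cV[R]_n})
    (v : N.-tuple 'cV[R]_l) : Prop := OLFeasible {
  ol_input_set : forall k, (k < N)%N -> V v`_k;
  ol_terminal : Zf (ol_nominal j v z N);
  ol_state_constraint : forall k i, (k < N)%N ->
    ((dot (c i) (ol_nominal j v z k))%:E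
     <= (p i)%:E - rho (dot (c i) \o ol_error j E k))%E;
  ol_input_constraint : forall k i, (k < N)%N ->
    ((dot (dd i) (K *m ol_nominal j v z k + v`_k))%:E
     <= (q i)%:E - rho (dot (dd i) \o (mulmx K \o ol_error j E k)))%E }.

(* The trajectory started from x enters the cost only, so that feasibility does
   not depend on x. *)
Definition ol_optimal (j : nat) (x z : 'cV[R]_n) (E : {RV P >-> 'cV[R]_n})
    (v : N.-tuple 'cV[R]_l) :=
  ol_feasible j z E v /\
  forall v', ol_feasible j z E v' -> (ol_cost j x v <= ol_cost j x v')%E.

End open_loop.

Section closed_loop.
Context d {T : measurableType d} {R : realType} (P : probability T R).
Context {n l : nat}.
Variables (A : 'M[R]_n) (B : 'M[R]_(n, l)) (K : 'M[R]_(l, n)).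
Variables (X0 : {RV P >-> 'cV[R]_n}) (W : nat -> {RV P >-> 'cV[R]_n}).

Record error_process (E : nat -> {RV P >-> 'cV[R]_n}) : Prop := ErrorProcess {
  error_init : forall w, E 0%N w = X0 w - mean X0;
  error_step : forall j w,
    E j.+1 w = (A + B *m K) *m E j w + W j w - mean (W j) }.

Variables (N : nat) (V : set 'cV[R]_l) (Zf : set 'cV[R]_n).
Variables (g : 'cV[R]_n * 'cV[R]_l -> R) (gf : 'cV[R]_n -> R).
Variables (rho : {RV P >-> R} -> \bar R).
Context {mx mu : nat}.
Variables (c : 'I_mx -> 'cV[R]_n) (p : 'I_mx -> R).
Variables (dd : 'I_mu -> 'cV[R]_l) (q : 'I_mu -> R).
Variable E : nat -> {RV P >-> 'cV[R]_n}.

Let optimal_at j x z v :=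
  @ol_optimal _ T R P n l A B K W N V Zf g gf rho mx mu c p dd q j x z (E j) v.

(* vstar j w is the optimal solution computed at time j for the outcome w.  It
   is left arbitrary where the problem solved there has no optimal solution, so
   that recursive feasibility is not built into the closed loop. *)
Record closed_loop (Xcl Zcl : nat -> {RV P >-> 'cV[R]_n})
    (Ucl : nat -> {RV P >-> 'cV[R]_l})
    (vstar : nat -> T -> N.-tuple 'cV[R]_l) : Prop := ClosedLoop {
  cl_state_init : forall w, Xcl 0%N w = X0 w;
  cl_nominal_init : forall w, Zcl 0%N w = mean X0;
  cl_optimal : forall j w,
    (exists v, optimal_at j (Xcl j w) (Zcl j w) v) ->
    optimal_at j (Xcl j w) (Zcl j w) (vstar j w);
  cl_input : forall j w, Ucl j w = K *m Xcl j w + (vstar j w)`_0;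
  cl_nominal_step : forall j w,
    Zcl j.+1 w =
      (A + B *m K) *m Zcl j w + B *m (vstar j w)`_0 + mean (W j);
  cl_state_step : forall j w,
    Xcl j.+1 w = A *m Xcl j w + B *m Ucl j w + W j w;
  cl_input_adapted : forall j, measurable_wrt (history Xcl j) (Ucl j);
  cl_nominal_adapted : forall j,
    measurable_wrt (history Xcl j) (Zcl j.+1) }.

End closed_loop.

(* Main.v *)
Require Import Defs.
From HB Require Import structures.
From mathcomp Require Import all_boot all_order all_algebra finmap.
From mathcomp Require Import complex.
From mathcomp Require Import all_classical all_reals all_analysis.
From mathcomp Require Import measurable_realfun.

Set Implicit Arguments.
Unset Strict Implicit.
Unset Printing Implicit Defensive.

Import Order.TTheory GRing.Theory Num.Theory.
Import numFieldNormedType.Exports.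

Local Open Scope classical_set_scope.
Local Open Scope ring_scope.

(* The closed-loop state splits as [Xcl j = Zcl j + E j] where the inputs do not
   influence [E j].  For every outcome the shifted candidate
   [(v_1, ..., v_(N-1), vf)] is feasible at time [j + 1], so that the nominal
   constraint [c^T z <= p - rho (c^T (E j))] holds at [z = Zcl j w] for all [w].
   Its right-hand side is deterministic, hence monotonicity and translativity
   turn the pointwise bound on [c^T Xcl j] into a bound on its risk. *)

Lemma dotD (R : realType) n (c x y : 'cV[R]_n) :
  dot c (x + y) = dot c x + dot c y.
Proof. by rewrite /dot mulmxDr mxE. Qed.

Section random_vectors.
Context d {T : measurableType d} {R : realType} (P : probability T R).

(** Both means are integrals of a coordinate against the common law. This carries the terminal
    invariance, assumed with the mean of [W 0], to every time. *)
Lemma mean_same_law n (X Y : {RV P >-> 'cV[R]_n}) :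
  finite_mean X -> finite_mean Y -> same_law X Y -> mean X = mean Y.
Proof.
move=> fX fY XY; apply/colP => i; rewrite !mxE; congr fine.
have mi : measurable_fun [set: 'cV[R]_n] (EFin \o (fun x : 'cV[R]_n => x i 0)).
  by apply/measurable_EFinP; exact: measurable_entry.
rewrite unlock.
have := @integral_distribution _ _ T _ R P X _ mi (fX i).
have := @integral_distribution _ _ T _ R P Y _ mi (fY i).
move=> /= <- <-.
by apply: eq_measure_integral => C mC _; exact: XY.
Qed.

Section risk_measures.
Variables (rho : {RV P >-> R} -> \bar R) (risk_rho : risk_measure rho).

(** Lets [rho] ignore which measurability structure a function is packed with; monotonicity is
    applied in both directions. *)
Lemma eq_risk (X Y : {RV P >-> R}) : X =1 Y -> rho X = rho Y.
Proof.
move=> XY; apply/eqP; rewrite eq_le.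
by apply/andP; split; apply: risk_monotone => //; apply: aeW => w; rewrite XY.
Qed.

(** Although [z] varies with the outcome, [rho Y] is a constant. When it is finite, [X] lies below
    [Y + (p - rho Y)], whose risk is exactly [p]. *)
Lemma risk_le_tightened (X Y : {RV P >-> R}) (z : T -> R) (p : R) :
  (forall w, X w = z w + Y w) -> (forall w, ((z w)%:E <= p%:E - rho Y)%E) ->
  (rho X <= p%:E)%E.
Proof.
move=> XzY zp.
(* An outcome is needed to exclude [rho Y = +oo]: there the bound at [w0] would put a real number
   below [-oo]. *)
have [w0 _] : [set: T] !=set0.
  apply/set0P/eqP => T0; have := probability_setT P.
  by rewrite T0 measure0 => /eqP; rewrite eqe eq_sym oner_eq0.
case rY : (rho Y) => [r| |].
- have -> : p%:E = rho ((Y : {mfun T >-> R}) + cst (p - r)).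
    by rewrite risk_translative// rY -EFinD addrC subrK.
  apply: risk_monotone => //; apply: aeW => w /=.
  have := zp w; rewrite rY -EFinB lee_fin => zw.
  by rewrite XzY addrC lerD2l.
- by have := zp w0; rewrite rY.
- by have := risk_neq_ninfty risk_rho Y; rewrite rY.
Qed.

Lemma tightened_sup_le (I : Type) (Y : I -> {RV P >-> R}) (i : I) (x p : R)
    (Z : {RV P >-> R}) : Z =1 Y i ->
  (x%:E <= p%:E - ereal_sup (range (fun i => rho (Y i))))%E ->
  (x%:E <= p%:E - rho Z)%E.
Proof.
move=> ZY /le_trans; apply; rewrite (eq_risk ZY).
by apply: leeB => //; apply: ereal_sup_ubound; exists i.
Qed.

End risk_measures.

End random_vectors.

Section recursive_feasibility.
Context d {T : measurableType d} {R : realType} (P : probability T R).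
Context {n l : nat}.
Variables (A : 'M[R]_n) (B : 'M[R]_(n, l)) (K : 'M[R]_(l, n)).
Variables (X0 : {RV P >-> 'cV[R]_n}) (W : nat -> {RV P >-> 'cV[R]_n}).
Variable E : nat -> {RV P >-> 'cV[R]_n}.
Hypothesis errorE : error_process A B K X0 W E.

(** The error recursion contains no input, so successive predictions agree on the error at each
    absolute time. *)
Lemma ol_errorE j k : ol_error A B K W j (E j) k =1 E (j + k)%N.
Proof.
elim: k => [|k IHk] w /=; first by rewrite addn0.
by rewrite IHk addnS (error_step errorE).
Qed.

Definition shift_inputs N (v : N.+1.-tuple 'cV[R]_l) (vf : 'cV[R]_l) :
  N.+1.-tuple 'cV[R]_l := [tuple of rcons (behead v) vf].

Lemma nth_shift_inputs N (v : N.+1.-tuple 'cV[R]_l) vf k : (k <= N)%N ->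
  (shift_inputs v vf)`_k = if k == N then vf else v`_k.+1.
Proof.
move=> kN; rewrite nth_rcons size_behead size_tuple /= nth_behead.
by move: kN; rewrite leq_eqVlt; case: eqVneq => [->|_ /= ->] //; rewrite ltnn.
Qed.

(** The state at step [k] depends on inputs of index below [k] only, so [vf] has not yet acted at
    [k = N], where the old terminal state is reached. *)
Lemma ol_nominal_shift N (v : N.+1.-tuple 'cV[R]_l) vf j z k : (k <= N)%N ->
  ol_nominal A B K W j.+1 (shift_inputs v vf)
    ((A + B *m K) *m z + B *m v`_0 + mean (W j)) k =
  ol_nominal A B K W j v z k.+1.
Proof.
elim: k => [|k IHk] kN /=; first by rewrite addn0.
rewrite IHk ?(ltnW kN)// nth_shift_inputs ?(ltnW kN)//.
by rewrite (ltn_eqF kN) addSnnS.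
Qed.

Variables (N : nat) (V : set 'cV[R]_l) (Zf : set 'cV[R]_n).
Variables (rho : {RV P >-> R} -> \bar R) (risk_rho : risk_measure rho).
Context {mx mu : nat}.
Variables (c : 'I_mx -> 'cV[R]_n) (p : 'I_mx -> R).
Variables (dd : 'I_mu -> 'cV[R]_l) (q : 'I_mu -> R).
Hypothesis Zf_state_constraint : forall z, Zf z -> forall i,
  ((dot (c i) z)%:E
   <= (p i)%:E - ereal_sup (range (fun j => rho (dot (c i) \o E j))))%E.
Variable vf : 'cV[R]_l.
Hypothesis Vvf : V vf.
Hypothesis Zf_invariant : forall j z, Zf z ->
  Zf ((A + B *m K) *m z + B *m vf + mean (W j)).
Hypothesis Zf_input_constraint : forall z, Zf z -> forall i,
  ((dot (dd i) (K *m z + vf))%:E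
   <= (q i)%:E
      - ereal_sup (range (fun j => rho (dot (dd i) \o (mulmx K \o E j)))))%E.

(** Stages [k < N] inherit the old constraints of stage [k.+1]. At stage [N] the nominal state is
    the old terminal state, which lies in [Zf], so the terminal assumptions take over. *)
Lemma ol_feasible_shift j z (v : N.+1.-tuple 'cV[R]_l) :
  ol_feasible A B K W V Zf rho c p dd q j z (E j) v ->
  ol_feasible A B K W V Zf rho c p dd q j.+1
    ((A + B *m K) *m z + B *m v`_0 + mean (W j)) (E j.+1) (shift_inputs v vf).
Proof.
case=> vV zNf state_ok input_ok.
have errS k : ol_error A B K W j.+1 (E j.+1) k =1
              ol_error A B K W j (E j) k.+1.
  by move=> w; rewrite !ol_errorE addSnnS.
split=> [k kN| |k i kN|k i kN].
- rewrite nth_shift_inputs//; case: eqVneq => // kN'.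
  by apply: vV; rewrite ltnS ltn_neqAle kN'.
- rewrite [ol_nominal _ _ _ _ _ _ _ _]/= ol_nominal_shift//.
  by rewrite nth_shift_inputs// eqxx; exact: Zf_invariant.
- rewrite ol_nominal_shift//; have [->|kN'] := eqVneq k N.
    (* The error at the last stage is [E (j.+1 + N)], one of the terms of the supremum over all
       times. *)
    apply: (tightened_sup_le risk_rho (Y := fun j => dot (c i) \o E j)
      (i := (j.+1 + N)%N)); last exact: Zf_state_constraint.
    by move=> w /=; rewrite ol_errorE.
  rewrite (eq_risk risk_rho (Y := dot (c i) \o ol_error A B K W j (E j) k.+1)).
    by apply: state_ok; rewrite ltnS ltn_neqAle kN'.
  by move=> w; congr dot; exact: errS.
- rewrite ol_nominal_shift// nth_shift_inputs//; have [->|kN'] := eqVneq k N.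
    apply: (tightened_sup_le risk_rho
      (Y := fun j => dot (dd i) \o (mulmx K \o E j))
      (i := (j.+1 + N)%N)); last exact: Zf_input_constraint.
    by move=> w /=; rewrite ol_errorE.
  rewrite (eq_risk risk_rho
    (Y := dot (dd i) \o (mulmx K \o ol_error A B K W j (E j) k.+1))).
    by apply: input_ok; rewrite ltnS ltn_neqAle kN'.
  by move=> w; congr (dot _ (_ *m _)); exact: errS.
Qed.

End recursive_feasibility.

Theorem mainTheorem2
  (d : measure_display) (T : measurableType d) (R : realType)
  (P : probability T R)
  (n l : nat) (A : 'M[R]_n) (B : 'M[R]_(n, l))
  (controllableAB : controllable A B)
  (X0 : {RV P >-> 'cV[R]_n}) (W : nat -> {RV P >-> 'cV[R]_n})
  (finite_mean_X0 : finite_mean X0)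
  (finite_mean_W : forall k, finite_mean (W k))
  (iidW : iid W)
  (indepW : noise_indep_of_past A B X0 W)
  (g : 'cV[R]_n * 'cV[R]_l -> R) (gf : 'cV[R]_n -> R)
  (continuous_g : continuous g)
  (bounded_below_g : exists b : R, forall xu, b <= g xu)
  (rho : {RV P >-> R} -> \bar R) (risk_rho : risk_measure rho)
  (mx mu : nat)
  (c : 'I_mx -> 'cV[R]_n) (p : 'I_mx -> R)
  (dd : 'I_mu -> 'cV[R]_l) (q : 'I_mu -> R)
  (K : 'M[R]_(l, n)) (stabilizingK : stabilizing A B K)
  (V : set 'cV[R]_l) (Zf : set 'cV[R]_n)
  (N : nat) (N_ge1 : (1 <= N)%N)
  (E : nat -> {RV P >-> 'cV[R]_n}) (errorE : error_process A B K X0 W E)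
  (* assumption (i) *)
  (Zf_nonempty : Zf !=set0)
  (Zf_state_constraint : forall z, Zf z -> forall i,
     ((dot (c i) z)%:E
      <= (p i)%:E - ereal_sup (range (fun j => rho (dot (c i) \o E j))))%E)
  (* assumption (ii) *)
  (terminal_controller : exists vf, V vf /\ forall z, Zf z ->
     Zf ((A + B *m K) *m z + B *m vf + mean (W 0%N)) /\
     forall i,
       ((dot (dd i) (K *m z + vf))%:E
        <= (q i)%:E
           - ereal_sup (range (fun j =>
               rho (dot (dd i) \o (mulmx K \o E j)))))%E)
  (Xcl Zcl : nat -> {RV P >-> 'cV[R]_n}) (Ucl : nat -> {RV P >-> 'cV[R]_l})
  (vstar : nat -> T -> N.-tuple 'cV[R]_l)
  (closedloop :
     closed_loop A B K X0 W V Zf g gf rho c p dd q E Xcl Zcl Ucl vstar)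
  (optimal_exists : forall j w,
     (exists v : N.-tuple 'cV[R]_l,
        ol_feasible A B K W V Zf rho c p dd q j (Zcl j w) (E j) v) ->
     exists v : N.-tuple 'cV[R]_l,
       ol_optimal A B K W V Zf g gf rho c p dd q
         j (Xcl j w) (Zcl j w) (E j) v)
  (feasible_at_0 : exists v : N.-tuple 'cV[R]_l,
     ol_feasible A B K W V Zf rho c p dd q 0%N (mean X0) (E 0%N) v) :
  forall j : nat,
    (forall i : 'I_mx, (rho (dot (c i) \o Xcl j) <= (p i)%:E)%E) /\
    (forall i : 'I_mu, (rho (dot (dd i) \o Ucl j) <= (q i)%:E)%E).
Proof.
have [vf [Vvf Zf_vf]] := terminal_controller.
have meanW k : mean (W k) = mean (W 0%N).
  by apply: mean_same_law => //; exact: iidW.2.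
case: N N_ge1 vstar closedloop optimal_exists feasible_at_0 => [//|N'] _ vs.
move=> cl opt_ex feas0.
have opt_feas j w : (exists v : N'.+1.-tuple 'cV[R]_l,
      ol_feasible A B K W V Zf rho c p dd q j (Zcl j w) (E j) v) ->
    ol_feasible A B K W V Zf rho c p dd q j (Zcl j w) (E j) (vs j w).
  by move=> /opt_ex /(cl_optimal cl) [].
(* Recursive feasibility, by induction on time with the outcome fixed: the noise enters the
   constraints only through its mean and [rho]. *)
have feas j w :
    ol_feasible A B K W V Zf rho c p dd q j (Zcl j w) (E j) (vs j w).
  elim: j => [|j IHj]; apply: opt_feas; first by rewrite (cl_nominal_init cl).
  exists (shift_inputs (vs j w) vf); rewrite (cl_nominal_step cl).
  apply: (@ol_feasible_shift _ _ _ _ _ _ _ _ _ X0) => //.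
  - by move=> k z /Zf_vf [+ _]; rewrite meanW.
  - by move=> z /Zf_vf [].
(* The feedback [K *m Xcl j w] acts on both summands, while the optimal input and the noise mean
   cancel from the difference. *)
have XZE j w : Xcl j w = Zcl j w + E j w.
  elim: j => [|j IHj].
    by rewrite (cl_state_init cl) (cl_nominal_init cl) (error_init errorE) subrKC.
  rewrite (cl_state_step cl) (cl_nominal_step cl) (error_step errorE).
  rewrite (cl_input cl) IHj mulmxDr mulmxA addrA -mulmxDl mulmxDr.
  rewrite -!addrA; congr (_ + _).
  rewrite addrCA; congr (_ + _).
  by rewrite [RHS]addrCA subrKC.
move=> j; split=> i.
(* The constraint is read at stage [0]; [ol_error] at [0] reduces to [E j] and is kept unreduced to
   match the feasibility record. *)
- apply: (risk_le_tightened risk_rho (Y := dot (c i) \o ol_error A B K W j (E j) 0)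
    (z := fun w => dot (c i) (Zcl j w))) => [w|w].
    by rewrite /= XZE dotD.
  exact: (ol_state_constraint (feas j w) i (ltn0Sn _)).
- apply: (risk_le_tightened risk_rho
    (Y := dot (dd i) \o (mulmx K \o ol_error A B K W j (E j) 0))
    (z := fun w => dot (dd i) (K *m Zcl j w + (vs j w)`_0))) => [w|w].
    by rewrite /= (cl_input cl) XZE -dotD mulmxDr addrAC.
  exact: (ol_input_constraint (feas j w) i (ltn0Sn _)).
Qed.
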